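(* Let $n\ge 1$ and let the data $P$, $\lambda$, $c$, $\alpha_i$, $\beta_i$, $m_i$, $M_i$ ($i=1,\dots,n$) be integers, with $P,\lambda,c>0$, $\alpha_i,\beta_i\ge 0$ and $0\le m_i\le M_i$. Suppose $\sum_{i=1}^n M_i>P$. Then the problem $$\sum_{i=1}^n k_i(x_i)+\sum_{i=1}^n\frac{c\,x_i^2}{2\lambda}\to\min,\qquad \sum_{i=1}^n x_i\ge P,\qquad x_i\in\{0\}\cup[m_i,M_i]\quad (i=1,\dots,n),$$ over real vectors $(x_1,\dots,x_n)$ has an optimal solution $x^*=(x_1^*,\dots,x_n^* )$ in which all fractional (non-integer) components have one and the same denominator, not exceeding $nc$; that is, there is a positive integer $D\le nc$ such that $D x_i^*$ is an integer for every non-integer component $x_i^*$.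
   Context: This is the problem of minimizing the delivery and storage costs of one product with at most one delivery from each of $n$ suppliers. $P$ is the total demand, $\lambda$ is the consumption intensity, $c$ (written $c_{xp}$ in the source) is the unit storage cost, $m_i$ and $M_i$ are the minimal and maximal delivery volumes of supplier $i$, and $x_i$ is the volume delivered by supplier $i$. The delivery cost function of supplier $i$ is $$k_i(v)=\begin{cases}0,& v=0,\\ \alpha_i+\beta_i v,& v>0.\end{cases}$$ An optimal solution is a feasible vector attaining the minimum of the objective. ''Denominator'' refers to a representation as a fraction of integers that need not be in lowest terms. *)

(* Defs.v *)
From mathcomp Require Import all_boot all_order all_algebra.
From mathcomp Require Import all_classical all_reals all_analysis.

Set Implicit Arguments.
Unset Strict Implicit.
Unset Printing Implicit Defensive.

Import Order.TTheory GRing.Theory Num.Theory.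
Local Open Scope ring_scope.

(* Only evaluated at v >= 0, since feasible volumes are nonnegative. *)
Definition delivery_cost (R : realType) (alpha beta : int) (v : R) : R :=
  if v == 0 then 0 else alpha%:~R + beta%:~R * v.

Definition total_cost (R : realType) (n : nat) (lambda c : int)
    (alpha beta : 'I_n -> int) (x : 'rV[R]_n) : R :=
  \sum_(i < n) delivery_cost (alpha i) (beta i) (x 0 i)
  + \sum_(i < n) (c%:~R * x 0 i ^+ 2) / (2 * lambda%:~R).

Definition feasible (R : realType) (n : nat) (P : int) (m M : 'I_n -> int)
    (x : 'rV[R]_n) : Prop :=
  P%:~R <= \sum_(i < n) x 0 i /\
  forall i : 'I_n, x 0 i = 0 \/ (m i)%:~R <= x 0 i <= (M i)%:~R.

Definition optimal (R : realType) (n : nat) (P lambda c : int)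
    (alpha beta m M : 'I_n -> int) (x : 'rV[R]_n) : Prop :=
  feasible P m M x /\
  forall y : 'rV[R]_n, feasible P m M y ->
    total_cost lambda c alpha beta x <= total_cost lambda c alpha beta y.

(* Main.v *)
Require Import Defs.
From mathcomp Require Import all_boot all_order all_algebra.
From mathcomp Require Import all_classical all_reals all_analysis.
From mathcomp Require Import ring.

Set Implicit Arguments.
Unset Strict Implicit.
Unset Printing Implicit Defensive.

Import Order.TTheory GRing.Theory Num.Theory.
Import numFieldNormedType.Exports.
Local Open Scope ring_scope.

(** Fix the set [S] of suppliers that are open, and charge the fixed cost of
    every supplier of [S].  What remains is a separable convex quadratic
    programme over a box.  Up to the factor [c / lambda], supplier [i] has
    marginal cost [d i + x i] with [d i = beta i * lambda / c], so the
    Karush-Kuhn-Tucker conditions ask for a common level [t >= 0] such that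
    [x i] is the projection of [t - d i] onto [[m i, M i]], with total volume
    at least [P], and equal to [P] unless [t = 0].  Such a level exists by the
    intermediate value theorem ([exists_level]), and convexity makes these
    conditions sufficient ([level_minimizes]), so no compactness argument is
    needed.

    Charging the fixed cost of an open supplier that delivers nothing only
    overestimates the cost, and nothing is overestimated when [S] is the
    support of the delivery vector.  Hence the best of the finitely many sets
    [S] whose total capacity covers the demand gives an optimal solution.

    For the denominators, let [F] be the set of non-integer components.  These
    lie strictly between their bounds, so [x i = t - d i] on [F]; moreover
    if [F] is nonempty then [t > 0], since at level [0] every open supplier
    delivers its minimal volume.  The total is therefore [P], and summing over
    [F] shows that [#|F| * c * t] is an integer.  Thus [D = #|F| * c <= n * c]
    clears all denominators ([level_common_denominator]); [D = 1] does when
    [F] is empty. *)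

(** * Projection onto an interval *)

(** The projection of [u] onto [[a, b]], for [a <= b]. *)
Definition clamp (R : realType) (a b u : R) : R := Num.max a (Num.min b u).

Lemma clamp_bounds (R : realType) (a b u : R) :
  a <= b -> a <= clamp a b u <= b.
Proof.
by move=> ab; rewrite /clamp le_max lexx /= ge_max ab ge_min lexx.
Qed.

Lemma clamp_low (R : realType) (a b u : R) : u <= a -> clamp a b u = a.
Proof. by move=> ua; rewrite /clamp max_l // ge_min ua orbT. Qed.

Lemma clamp_high (R : realType) (a b u : R) :
  a <= b -> b <= u -> clamp a b u = b.
Proof. by move=> ab bu; rewrite /clamp min_l // max_r. Qed.

Lemma clamp_mid (R : realType) (a b u : R) :
  a <= u -> u <= b -> clamp a b u = u.
Proof. by move=> au ub; rewrite /clamp min_r // max_r. Qed.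

(** The variational inequality characterizing the projection. *)
Lemma clamp_variational (R : realType) (a b u y : R) :
  a <= y <= b -> (u - clamp a b u) * (y - clamp a b u) <= 0.
Proof.
move=> /andP[ay yb]; have ab := le_trans ay yb.
have [ua|au] := leP u a.
  by rewrite clamp_low // mulr_le0_ge0 ?subr_le0 ?subr_ge0.
have [bu|ub] := leP b u.
  by rewrite clamp_high // mulr_ge0_le0 ?subr_le0 ?subr_ge0.
by rewrite (clamp_mid (ltW au) (ltW ub)) subrr mul0r.
Qed.

Lemma clamp_nonint (R : realType) (a b : int) (u : R) :
  clamp a%:~R b%:~R u \isn't a Num.int -> clamp a%:~R b%:~R u = u.
Proof.
by rewrite /clamp maxEle minEle; do 2!case: ifP => //; rewrite ?intr_int.
Qed.

Lemma clamp_continuous (R : realType) (a b d : R) :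
  continuous (fun t => clamp a b (t - d)).
Proof.
apply: max_fun_continuous; first by move=> t; exact: cvg_cst.
apply: min_fun_continuous; first by move=> t; exact: cvg_cst.
by move=> t; apply: cvgB; [exact: cvg_id | exact: cvg_cst].
Qed.

(** * The problem with a fixed set of open suppliers *)

Lemma exists_level (R : realType) (I : finType) (S : {set I})
    (a b d : I -> R) (p : R) :
  (forall i, 0 <= d i) -> (forall i, 0 <= a i) -> (forall i, a i <= b i) ->
  p <= \sum_(i in S) b i ->
  exists2 t : R, 0 <= t &
    let s := \sum_(i in S) clamp (a i) (b i) (t - d i) in
    p <= s /\ (t = 0 \/ s = p).
Proof.
move=> d0 a0 ab pb.
pose f t := \sum_(i in S) clamp (a i) (b i) (t - d i).
have [pf|fp] := leP p (f 0); first by exists 0 => //; split=> //; left.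
(* Beyond this level every component has reached its upper bound. *)
pose T := \sum_i (b i + d i).
have b0 i : 0 <= b i by apply: le_trans (ab i).
have T0 : 0 <= T by apply: sumr_ge0 => i _; rewrite addr_ge0.
have fT : f T = \sum_(i in S) b i.
  apply: eq_bigr => i _; apply: clamp_high => //.
  rewrite lerBrDr /T (bigD1 i) //= lerDl.
  by apply: sumr_ge0 => j _; rewrite addr_ge0.
have fcont : continuous f.
  apply: continuous_big => [|i _]; first exact: add_continuous.
  exact: clamp_continuous.
have [||t] := @IVT R f 0 T p T0.
- exact: continuous_subspaceT.
- by rewrite ge_min (ltW fp) le_max fT pb orbT.
rewrite in_itv /= => /andP[t0 _] ft; exists t => //=; rewrite -/(f t) ft.
by split=> //; right.
Qed.

(** The cost when every supplier of [S] is charged its fixed cost, even for a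
    zero delivery, and the other suppliers are ignored. *)
Definition open_cost (R : realType) (n : nat) (lambda c : int)
    (alpha beta : 'I_n -> int) (S : {set 'I_n}) (x : 'I_n -> R) : R :=
  \sum_(i in S) ((alpha i)%:~R + (beta i)%:~R * x i
                 + (c%:~R * x i ^+ 2) / (2 * lambda%:~R)).

(** The level rule satisfies the Karush-Kuhn-Tucker conditions, and these
    suffice for optimality because the cost is convex. *)
Lemma level_minimizes (R : realType) (n : nat) (lambda c : int)
    (alpha beta : 'I_n -> int) (S : {set 'I_n}) (a b x y : 'I_n -> R)
    (p t : R) :
  0 < lambda -> 0 < c -> 0 <= t ->
  (forall i, i \in S ->
     x i = clamp (a i) (b i) (t - (beta i)%:~R * lambda%:~R / c%:~R)) ->
  t = 0 \/ \sum_(i in S) x i = p ->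
  (forall i, i \in S -> a i <= y i <= b i) -> p <= \sum_(i in S) y i ->
  open_cost lambda c alpha beta S x <= open_cost lambda c alpha beta S y.
Proof.
move=> l0 c0 t0 xE tp yab py; rewrite /open_cost -subr_ge0 -sumrB.
set l : R := lambda%:~R; set k : R := c%:~R.
have lR : 0 < l by rewrite /l ltr0z.
have kR : 0 < k by rewrite /k ltr0z.
have tsum : 0 <= \sum_(i in S) (k / l * t) * (y i - x i).
  rewrite -mulr_sumr sumrB; case: tp => [->|->].
    by rewrite mulr0 mul0r.
  by rewrite mulr_ge0 ?subr_ge0 // mulr_ge0 // divr_ge0 // ltW.
apply: (le_trans tsum); apply: ler_sum => i iS.
have := clamp_variational (t - (beta i)%:~R * l / k) (yab i iS).
rewrite -(xE i iS) => var.
set B : R := (beta i)%:~R in var *; set A : R := (alpha i)%:~R.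
(* The gap is a square minus the variational inequality, both scaled. *)
rewrite -subr_ge0.
have -> : A + B * y i + k * y i ^+ 2 / (2 * l)
          - (A + B * x i + k * x i ^+ 2 / (2 * l))
          - k / l * t * (y i - x i)
  = k / l * ((y i - x i) ^+ 2 / 2
             - (t - B * l / k - x i) * (y i - x i)).
  by field; rewrite !gt_eqF.
by rewrite mulr_ge0 ?divr_ge0 ?(ltW lR) ?(ltW kR) // subr_ge0 (le_trans var) //
   divr_ge0 ?sqr_ge0.
Qed.

(** * Denominators *)

Lemma level_common_denominator (R : realType) (n : nat) (P lambda c : int)
    (beta m M : 'I_n -> int) (S : {set 'I_n}) (x : 'I_n -> R) (t : R) :
  (1 <= n)%N -> 0 <= lambda -> 0 < c ->
  (forall i, 0 <= beta i) -> (forall i, 0 <= m i) ->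
  (forall i, i \in S ->
     x i = clamp (m i)%:~R (M i)%:~R
             (t - (beta i)%:~R * lambda%:~R / c%:~R)) ->
  (forall i, i \notin S -> x i = 0) ->
  t = 0 \/ \sum_(i in S) x i = P%:~R ->
  exists D : int,
    [/\ 0 < D, D <= n%:Z * c
      & forall i, x i \isn't a Num.int -> D%:~R * x i \is a Num.int].
Proof.
move=> n1 l0 c0 b0 m0 xE x0 tP.
pose F := [set i | x i \isn't a Num.int].
have FS i : i \in F -> i \in S.
  by rewrite inE; apply: contraR => /x0 ->; exact: rpred0.
have FE i : i \in F -> x i = t - (beta i)%:~R * lambda%:~R / c%:~R.
  move=> iF; rewrite (xE i (FS i iF)); apply: clamp_nonint.
  by rewrite -(xE i (FS i iF)); move: iF; rewrite inE.
have cR : 0 < c%:~R :> R by rewrite ltr0z.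
have [F0|/set0Pn[j jF]] := eqVneq F finset.set0.
  exists 1; split=> // [|i]; first by rewrite mulr_ege1 // ?lez_nat // -gtz0_ge1.
  by move=> xi; have : i \in F; [rewrite inE | rewrite F0 finset.in_set0].
have sumP : \sum_(i in S) x i = P%:~R.
  case: tP => // t0; move: (jF); rewrite inE (xE j (FS j jF)) t0 clamp_low.
    by rewrite intr_int.
  rewrite (@le_trans _ _ 0) ?ler0z // sub0r oppr_le0.
  by rewrite divr_ge0 ?(ltW cR) // mulr_ge0 ?ler0z.
exists (#|F|%:Z * c); split.
- by rewrite mulr_gt0 // ltz_nat; apply/card_gt0P; exists j.
- by rewrite ler_pM2r // lez_nat -[leqRHS]card_ord max_card.
move=> i xi; have iF : i \in F by rewrite inE.
have ctE : #|F|%:R * c%:~R * t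
   = c%:~R * P%:~R - c%:~R * (\sum_(i | i \notin F) x i)
     + \sum_(i in F) (beta i)%:~R * lambda%:~R.
  have -> : P%:~R = \sum_(i in F) x i + \sum_(i | i \notin F) x i :> R.
    rewrite -sumP [LHS]big_mkcond -[RHS](bigID [in F] xpredT) /=.
    by apply: eq_bigr => k _; case: ifPn => // /x0.
  rewrite (eq_bigr _ FE) sumrB sumr_const -(mulr_natl t)
    -(mulr_suml _ _ _ (c%:~R^-1)).
  by field; rewrite gt_eqF.
have ctint : #|F|%:R * c%:~R * t \is a Num.int.
  rewrite ctE rpredD ?rpredB ?rpredM ?intr_int //.
    by apply: rpred_sum => k; rewrite inE negbK.
  by apply: rpred_sum => k _; rewrite rpredM ?intr_int.
rewrite (FE i iF) rmorphM /= -pmulrn.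
have -> : #|F|%:R * c%:~R * (t - (beta i)%:~R * lambda%:~R / c%:~R)
   = #|F|%:R * c%:~R * t - #|F|%:R * ((beta i)%:~R * lambda%:~R).
  by field; rewrite gt_eqF.
by rewrite rpredB // !rpredM ?intr_int // rpred_nat.
Qed.

(** * Comparison with the original cost *)

Lemma total_cost_le_open (R : realType) (n : nat) (lambda c : int)
    (alpha beta : 'I_n -> int) (S : {set 'I_n}) (x : 'rV[R]_n) :
  (forall i, 0 <= alpha i) -> (forall i, i \notin S -> x 0 i = 0) ->
  total_cost lambda c alpha beta x
    <= open_cost lambda c alpha beta S (x 0).
Proof.
move=> a0 x0; rewrite /total_cost /open_cost -big_split [leRHS]big_mkcond /=.
apply: ler_sum => i _; rewrite /delivery_cost.
case: (boolP (i \in S)) => [_|/x0 ->].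
  by case: eqP => [->|//]; rewrite !mulr0 addr0 lerD2r ler0z.
by rewrite eqxx expr0n mulr0 mul0r addr0.
Qed.

Lemma open_cost_support (R : realType) (n : nat) (lambda c : int)
    (alpha beta : 'I_n -> int) (x : 'rV[R]_n) :
  open_cost lambda c alpha beta [set i | x 0 i != 0] (x 0)
    = total_cost lambda c alpha beta x.
Proof.
rewrite /total_cost /open_cost -big_split [LHS]big_mkcond /=.
apply: eq_bigr => i _; rewrite inE /delivery_cost.
by case: eqP => [->|//] /=; rewrite expr0n !mulr0 mul0r addr0.
Qed.

Theorem mainTheorem1 (R : realType) (n : nat) (P lambda c : int)
    (alpha beta m M : 'I_n -> int)
    (hn : (1 <= n)%N)
    (hP : 0 < P) (hlambda : 0 < lambda) (hc : 0 < c)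
    (halpha : forall i, 0 <= alpha i)
    (hbeta : forall i, 0 <= beta i)
    (hm : forall i, 0 <= m i)
    (hmM : forall i, m i <= M i)
    (hsum : P < \sum_(i < n) M i) :
  exists x : 'rV[R]_n,
    optimal P lambda c alpha beta m M x /\
    exists D : int,
      [/\ 0 < D, D <= n%:Z * c
        & forall i : 'I_n,
            x 0 i \isn't a Num.int -> D%:~R * x 0 i \is a Num.int].
Proof.
(* An optimal solution for a set [S] whose capacity covers the demand. *)
pose good (S : {set 'I_n}) (x : 'rV[R]_n) :=
  [/\ feasible P m M x,
      forall i, i \notin S -> x 0 i = 0,
      forall y : 'I_n -> R,
        (forall i, i \in S -> (m i)%:~R <= y i <= (M i)%:~R) ->
        P%:~R <= \sum_(i in S) y i ->
        open_cost lambda c alpha beta S (x 0)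
          <= open_cost lambda c alpha beta S y
    & exists D : int,
        [/\ 0 < D, D <= n%:Z * c
          & forall i : 'I_n,
            x 0 i \isn't a Num.int -> D%:~R * x 0 i \is a Num.int]].
pose covers (S : {set 'I_n}) := P%:~R <= \sum_(i in S) (M i)%:~R :> R.
have solve S : exists x, covers S -> good S x.
  have [PM|_] := boolP (covers S); last by exists 0.
  pose d i : R := (beta i)%:~R * lambda%:~R / c%:~R.
  have d0 i : 0 <= d i.
    by rewrite divr_ge0 ?mulr_ge0 ?ler0z ?(ltW hlambda) ?(ltW hc).
  have [|i|t t0 /= [Ps tP]] := exists_level d0 _ _ PM (a := fun i => (m i)%:~R).
  - by move=> i; rewrite ler0z.
  - by rewrite ler_int.
  pose x : 'rV[R]_n := \row_i
    if i \in S then clamp (m i)%:~R (M i)%:~R (t - d i) else 0.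
  have xS i : i \in S -> x 0 i = clamp (m i)%:~R (M i)%:~R (t - d i).
    by rewrite mxE => ->.
  have xN i : i \notin S -> x 0 i = 0 by rewrite mxE => /negbTE ->.
  have sumx : \sum_(i in S) x 0 i
      = \sum_(i in S) clamp (m i)%:~R (M i)%:~R (t - d i) by exact: eq_bigr.
  rewrite -sumx in Ps tP.
  exists x => _; split=> //.
  - split=> [|i].
      rewrite (bigID [in S]) /= [X in _ + X]big1 ?addr0 //.
    have [iS|/xN] := boolP (i \in S); last by left.
    by right; rewrite xS // clamp_bounds // ler_int.
  - move=> y yS Py; apply: level_minimizes hlambda hc t0 xS tP yS Py.
  - exact: level_common_denominator hn (ltW hlambda) hc hbeta hm xS xN tP.
have [X XP] := boolp.choice solve.
have coversT : covers [set: 'I_n].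
  rewrite /covers -rmorph_sum /= ler_int.
  by under eq_bigl do rewrite inE; exact: ltW.
pose cost S := open_cost lambda c alpha beta S (X S 0).
have [S0 cS0 S0min] := arg_minP cost coversT.
have [Xfeas XN _ XD] := XP S0 cS0.
exists (X S0); split=> //; split=> // y [Py yb].
(* Compare with the best vector for the support of [y]. *)
pose S := [set i | y 0 i != 0].
have sumy : \sum_i y 0 i = \sum_(i in S) y 0 i.
  rewrite [RHS]big_mkcond; apply: eq_bigr => i _.
  by rewrite inE; case: eqP.
have yS i : i \in S -> (m i)%:~R <= y 0 i <= (M i)%:~R.
  by rewrite inE; case: (yb i) => // ->; rewrite eqxx.
rewrite sumy in Py.
have cS : covers S.
  by apply: (le_trans Py); apply: ler_sum => i /yS /andP[].
have [_ _ Smin _] := XP S cS.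
rewrite -(open_cost_support _ _ _ _ y).
apply: le_trans (Smin _ yS Py); apply: le_trans (S0min S cS).
exact: total_cost_le_open.
Qed.
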